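(* Let $n,m,T\in\mathbb{N}$, $U\subset\mathbb{R}^m$, $X_t\subset\mathbb{R}^n$ for $t\in\{0,\dots,T\}$. Suppose $J:U^T\times\prod_{t=0}^T X_t\to\mathbb{R}$ is an additively separable function with associated cost functions $\{c_t\}_{t=0}^T$. Then $J$ is monotonically backward separable. Moreover, if the functions $c_t$ are bounded over $X_t\times U$ for $0\le t\le T-1$ and $c_T$ is bounded over $X_T$, then $J$ is naturally monotonically backward separable.
   Context: Write $\mathbf{u}=(u(0),\dots,u(T-1))\in U^T$ and $\mathbf{x}=(x(0),\dots,x(T))\in\prod_{t=0}^T X_t$. **Additively separable.** There exist $c_T:X_T\to\mathbb{R}$ and $c_t:X_t\times U\to\mathbb{R}$, $t=0,\dots,T-1$, such that $J(\mathbf{u},\mathbf{x})=\sum_{t=0}^{T-1}c_t(x(t),u(t))+c_T(x(T))$. **Monotonically backward separable.** $\mathrm{Image}\{g\}$ denotes the image set of a function $g$. $J$ is monotonically backward separable if there exist representation maps $\phi_T:X_T\to\mathbb{R}$ and $\phi_t:X_t\times U\times\mathrm{Image}\{\phi_{t+1}\}\to\mathbb{R}$ for $t=0,\dots,T-1$ such that (1) $J(\mathbf{u},\mathbf{x})=\phi_0(x(0),u(0),\phi_1(x(1),u(1),\dots\phi_T(x(T))\dots))$; and (2) each $\phi_t$ is monotonic in its third argument: if $z,w\in\mathrm{Image}\{\phi_{t+1}\}$ and $z\ge w$ then $\phi_t(x,u,z)\ge\phi_t(x,u,w)$ for all $(x,u)\in X_t\times U$. **Naturally monotonically backward separable.**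 $J$ is naturally monotonically backward separable if (1), (2) hold and the representation maps satisfy in addition: (3) (upper semi-continuity in the third argument) for any $t\in\{0,\dots,T-1\}$, $x\in X_t$, $u\in U$ and any monotonically decreasing sequence $\{z_n\}_{n\in\mathbb{N}}\subset\mathrm{Image}\{\phi_{t+1}\}$ (i.e. $z_{n+1}\le z_n$ for all $n$), $\lim_{n\to\infty}\phi_t(x,u,z_n)=\phi_t(x,u,\lim_{n\to\infty}z_n)$; and (4) (boundedness) for each $t\in\{0,\dots,T\}$ there exists $R>0$ such that $\mathrm{Image}\{\phi_t\}\subset\{y\in\mathbb{R}:|y|<R\}$. *)

(* Defs.v *)
From mathcomp Require Import all_boot all_order all_algebra.
From mathcomp Require Import all_classical all_reals all_analysis.

Set Implicit Arguments.
Unset Strict Implicit.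
Unset Printing Implicit Defensive.

Import Order.TTheory GRing.Theory Num.Theory.
Import numFieldNormedType.Exports.

Local Open Scope classical_set_scope.
Local Open Scope ring_scope.

(* A time t in {0, ..., T-1} seen as a time in {0, ..., T}; the final time T is
   [ord_max]. *)
Definition stage (T : nat) (t : 'I_T) : 'I_T.+1 := widen_ord (leqnSn T) t.

Section Separability.
Variables (R : realType) (n m T : nat).
Variables (U : set 'rV[R]_m) (X : 'I_T.+1 -> set 'rV[R]_n).

(* Functions on U^T, prod_t X_t, X_t * U, etc. are total functions on the ambient
   types; every condition below only involves arguments in the stated domains
   (with one exception, see [usc_rep]). *)
Variable J : ('I_T -> 'rV[R]_m) -> ('I_T.+1 -> 'rV[R]_n) -> R.

Definition admissible (u : 'I_T -> 'rV[R]_m) (x : 'I_T.+1 -> 'rV[R]_n) : Prop :=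
  (forall t, U (u t)) /\ (forall t, X t (x t)).

Definition additive_costs (c : 'I_T -> 'rV[R]_n -> 'rV[R]_m -> R)
    (cT : 'rV[R]_n -> R) : Prop :=
  forall u x, admissible u x ->
    J u x = \sum_(t < T) c t (x (stage t)) (u t) + cT (x ord_max).

Section Representation.
Variables (phi : 'I_T -> 'rV[R]_n -> 'rV[R]_m -> R -> R) (phiT : 'rV[R]_n -> R).

(* [rep_image t] is Image{phi_t} for t <= T, phi_t having domain
   X_t * U * Image{phi_{t+1}} for t < T; it is empty for t > T. *)
Inductive rep_image : nat -> set R :=
| rep_image_last x : X ord_max x -> rep_image T (phiT x)
| rep_image_step (t : 'I_T) x u z :
    X (stage t) x -> U u -> rep_image t.+1 z -> rep_image t (phi t x u z).

(* phi_0(x(0), u(0), phi_1(x(1), u(1), ... phi_T(x(T)) ...)); [enum 'I_T] lists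
   0, ..., T-1 in increasing order. *)
Definition rep_value (u : 'I_T -> 'rV[R]_m) (x : 'I_T.+1 -> 'rV[R]_n) : R :=
  foldr (fun t z => phi t (x (stage t)) (u t) z) (phiT (x ord_max)) (enum 'I_T).

Definition represents : Prop :=
  forall u x, admissible u x -> J u x = rep_value u x.

Definition monotone_rep : Prop :=
  forall (t : 'I_T) z w, rep_image t.+1 z -> rep_image t.+1 w -> w <= z ->
    forall x u, X (stage t) x -> U u -> phi t x u w <= phi t x u z.

(* The limit l need not belong to Image{phi_{t+1}}: the value of phi_t at such
   an l is that of the total function [phi t]. *)
Definition usc_rep : Prop :=
  forall (t : 'I_T) x u, X (stage t) x -> U u ->
    forall z : nat -> R, (forall k, rep_image t.+1 (z k)) ->
      (forall k, z k.+1 <= z k) ->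
      forall l, z @ \oo --> l -> (fun k => phi t x u (z k)) @ \oo --> phi t x u l.

Definition bounded_rep : Prop :=
  forall t : 'I_T.+1, exists2 M : R, 0 < M & rep_image t `<=` [set y | `|y| < M].

End Representation.

Definition monotonically_backward_separable : Prop :=
  exists phi phiT, represents phi phiT /\ monotone_rep phi phiT.

Definition naturally_monotonically_backward_separable : Prop :=
  exists phi phiT, [/\ represents phi phiT, monotone_rep phi phiT,
                       usc_rep phi phiT & bounded_rep phi phiT].

End Separability.

(* Main.v *)
Require Import Defs.
From mathcomp Require Import all_boot all_order all_algebra.
From mathcomp Require Import all_classical all_reals all_analysis.

Set Implicit Arguments.
Unset Strict Implicit.
Unset Printing Implicit Defensive.

Import Order.TTheory GRing.Theory Num.Theory.
Import numFieldNormedType.Exports.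

Local Open Scope classical_set_scope.
Local Open Scope ring_scope.

(** Take the translations [phi t x u z = c t x u + z], with [cT] at the final time: nesting them
    unfolds into the additive cost. A translation of the real line is increasing and continuous,
    which gives monotonicity and the limit condition, even for limits outside the image. For
    boundedness, each value of the stage [k] map is a sum of costs from stage [k] to the end, so
    bounds on the individual costs add up to a bound on the image ([additive_rep_image_le]). *)

Lemma foldr_addr (R : nmodType) (I : Type) (F : I -> R) (a : R) (s : seq I) :
  foldr (fun i z => F i + z) a s = \sum_(i <- s) F i + a.
Proof.
elim: s => [|i s IHs] /=; first by rewrite big_nil add0r.
by rewrite big_cons IHs addrA.
Qed.

Section AdditiveRepresentation.
Context (R : realType) (n m T : nat).
Context (U : set 'rV[R]_m) (X : 'I_T.+1 -> set 'rV[R]_n).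
Context (J : ('I_T -> 'rV[R]_m) -> ('I_T.+1 -> 'rV[R]_n) -> R).
Context (c : 'I_T -> 'rV[R]_n -> 'rV[R]_m -> R) (cT : 'rV[R]_n -> R).

Definition additive_rep (t : 'I_T) (x : 'rV[R]_n) (u : 'rV[R]_m) (z : R) : R :=
  c t x u + z.

Lemma additive_represents :
  additive_costs U X J c cT -> represents U X J additive_rep cT.
Proof.
move=> hJ u x ux; rewrite hJ// /rep_value /additive_rep.
by rewrite (foldr_addr (fun t => c t (x (stage t)) (u t))) big_enum.
Qed.

Lemma additive_monotone_rep : monotone_rep U X additive_rep cT.
Proof. by move=> t z w _ _ wz x u _ _; rewrite lerD2l. Qed.

Lemma additive_usc_rep : usc_rep U X additive_rep cT.
Proof.
by move=> t x u _ _ z _ _ l zl; apply: cvgD => //; exact: cvg_cst.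
Qed.

(** Backward induction in time along [rep_image]: each step adds one cost, and the triangle
    inequality adds its bound to the tail sum. *)
Lemma additive_rep_image_le (C : 'I_T -> R) (CT : R) (k : nat) (y : R) :
  (forall t x u, X (stage t) x -> U u -> `|c t x u| <= C t) ->
  (forall x, X ord_max x -> `|cT x| <= CT) ->
  rep_image U X additive_rep cT k y ->
  `|y| <= \sum_(s < T | (k <= s)%N) C s + CT.
Proof.
move=> cC cTC; elim=> [x Xx|t x u z Xx Uu _ IHz].
  (* At [k = T] no stage remains, so the sum is empty. *)
  by rewrite big_pred0 ?add0r ?cTC// => s; rewrite leqNgt ltn_ord.
(* Splitting off the term [t] leaves the stages [s > t], which index the sum in the induction
   hypothesis. *)
rewrite (bigD1 t)//= -addrA (le_trans (ler_normD _ _))// lerD ?cC//.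
rewrite (eq_bigl (fun s : 'I_T => (t < s)%N)) // => s.
by rewrite ltn_neqAle andbC eq_sym.
Qed.

Lemma additive_bounded_rep :
  (forall t : 'I_T, [bounded c t p.1 p.2 | p in X (stage t) `*` U]) ->
  [bounded cT x | x in X ord_max] ->
  bounded_rep U X additive_rep cT.
Proof.
move=> cbnd /pinfty_ex_gt0[CT _ cTC] k.
have /choice[C cC] (t : 'I_T) :
    exists M, forall x u, X (stage t) x -> U u -> `|c t x u| <= M.
  have /pinfty_ex_gt0[M _ cM] := cbnd t.
  by exists M => x u Xx Uu; exact: (cM (x, u)).
set B := \sum_(s < T | (k <= s)%N) C s + CT.
(* The absolute value guards against a negative [B], possible when a stage domain is empty and its
   bound arbitrary; the added 1 makes the radius positive and the inequality strict. *)
exists (`|B| + 1); first by rewrite ltr_wpDl.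
move=> y /(additive_rep_image_le cC cTC) yB /=.
by rewrite (le_lt_trans yB)// (le_lt_trans (ler_norm _))// ltrDl.
Qed.

End AdditiveRepresentation.

Theorem lemma4 (R : realType) (n m T : nat)
    (U : set 'rV[R]_m) (X : 'I_T.+1 -> set 'rV[R]_n)
    (J : ('I_T -> 'rV[R]_m) -> ('I_T.+1 -> 'rV[R]_n) -> R)
    (c : 'I_T -> 'rV[R]_n -> 'rV[R]_m -> R) (cT : 'rV[R]_n -> R)
    (hJ : additive_costs U X J c cT) :
  monotonically_backward_separable U X J /\
  ((forall t : 'I_T, [bounded c t p.1 p.2 | p in X (stage t) `*` U]) ->
   [bounded cT x | x in X ord_max] ->
   naturally_monotonically_backward_separable U X J).
Proof.
have rep := additive_represents hJ.
have mono := additive_monotone_rep (U := U) (X := X) (c := c) (cT := cT).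
split; first by exists (additive_rep c), cT.
move=> cbnd cTbnd; exists (additive_rep c), cT; split => //.
  exact: additive_usc_rep.
exact: additive_bounded_rep.
Qed.
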